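(* Let $S_n$ be the symmetric group with Coxeter generators the simple transpositions, and let $J=\{(1,2),\ldots,(n-2,n-1)\}$. For $\sigma,\omega\in S_n$, let $\mathcal{P}(\sigma,\omega)$ be the collection of subsets $B\subseteq\{1,\ldots,n-1\}$ for which the following two conditions are satisfied: (1) for all $i\in B$, $\sigma<(i,n)\sigma$ holds in the Bruhat order; (2) $\omega$ is the supremum of the set $\{\sigma\}\cup\{(i,n)\sigma\}_{i\in B}$ in the Bruhat order. Then, for all $\sigma,\omega\in S_n$, $$R_{\sigma,\omega,J}=\sum_{B\in\mathcal{P}(\sigma,\omega)}(q-1)^{|B|}.$$ In particular, the decomposition $P^\partial_{\sigma,\omega}=Q^J_{\sigma,\omega}+I^J_{\sigma,\omega}$ is in this case the hypercube decomposition, that is, for all $\sigma,\omega\in S_n$, $$Q^J_{\sigma,\omega}=\frac{q^{\ell(\omega)-\ell(\sigma)}}{1-q}\sum_{\emptyset\neq B\subseteq\mathcal{D}(\sigma)}(q^{-1}-1)^{|B|}\,d(P_{\sigma^B,\omega}),$$ where $\mathcal{D}(\sigma)=\{1\le i\le n-1:\ \sigma<(i,n)\sigma\}$ and $\sigma^B\in S_n$ is the supremum of the set $\{(i,n)\sigma\}_{i\in B}$ in the Bruhat order.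
   Context: Permutations are functions composed right to left. Let $\mathcal{L}=\mathbb{Z}[v,v^{-1}]$, $q=v^{-2}$, $\alpha=v^{-1}-v$, and $d:\mathcal{L}\to\mathcal{L}$ the ring involution $d(v)=v^{-1}$. For a finite Coxeter system $(W,S)$ (here $W=S_n$) with length $\ell$, Bruhat order $\leq$ and longest element $\omega_0$, the Hecke algebra $\mathcal{H}(W)$ is the $\mathcal{L}$-algebra with $\mathcal{L}$-basis $\{h_\omega\}_{\omega\in W}$ and relations $h_{\omega_1}h_{\omega_2}=h_{\omega_1\omega_2}$ if $\ell(\omega_1)+\ell(\omega_2)=\ell(\omega_1\omega_2)$, and $(h_s+v)(h_s-v^{-1})=0$ for $s\in S$. $d$ extends to a ring involution of $\mathcal{H}(W)$ with $d(h_\omega)=(h_{\omega^{-1}})^{-1}$. $\langle\,,\rangle$ is the natural pairing of $\mathcal{H}(W)^*=\mathrm{Hom}_{\mathcal{L}}(\mathcal{H}(W),\mathcal{L})$ with $\mathcal{H}(W)$, and $\{h^\omega\}$ is the basis dual to $\{h_\omega\}$. $\{c_\omega\}$ is the unique (Kazhdan-Lusztig) basis with $d(c_\omega)=c_\omega$, $\langle h^\omega,c_\omega\rangle=1$, $\langle h^\sigma,c_\omega\rangle\in v\mathbb{Z}[v]$ for $\sigma\neq\omega$. The Kazhdan-Lusztig polynomials are $P_{\sigma,\omega}=v^{\ell(\sigma)-\ell(\omega)}\langle h^\sigma,c_\omega\rangle\in\mathbb{Z}[q]$ and $P^\partial_{\sigma,\omega}=\frac{q^{\ell(\omega)-\ell(\sigma)}d(P_{\sigma,\omega})-P_{\sigma,\omega}}{q-1}$.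 For $\omega,\tau\in W$ put $f_{\omega,\tau}=h_\tau^{-1}h_{\tau\omega}$; for fixed $\tau$, $\{f_{\omega,\tau}\}_{\omega\in W}$ is a basis of $\mathcal{H}(W)$, with dual basis $\{f^{\omega,\tau}\}_{\omega\in W}$. For $J\subseteq S$, $\omega_0^J$ is the longest element of the subgroup $W_J$ generated by $J$. The $J$-relative $R$-polynomials are $R_{\sigma,\omega,J}=v^{\ell(\sigma)-\ell(\omega)}\langle f^{\sigma,\omega_0\omega_0^J},h_\omega\rangle\in\mathcal{L}$. Put $\check I^\tau_{\sigma,\omega}=\alpha^{-1}\langle f^{\sigma,\tau}-h^\sigma,c_\omega\rangle\in\mathcal{L}$, $I^J_{\sigma,\omega}=v^{\ell(\sigma)-\ell(\omega)+1}\check I^{\omega_0^J}_{\sigma,\omega}$ and $Q^J_{\sigma,\omega}=v^{\ell(\sigma)-\ell(\omega)+1}d(\check I^{\omega_0\omega_0^J}_{\sigma,\omega})$; then $P^\partial_{\sigma,\omega}=Q^J_{\sigma,\omega}+I^J_{\sigma,\omega}$. *)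

(* Defs.v *)
From HB Require Import structures.
From mathcomp Require Import all_boot all_order all_fingroup all_algebra.
From mathcomp Require Import boolp classical_sets.
Set Implicit Arguments.
Unset Strict Implicit.
Unset Printing Implicit Defensive.
Import Order.TTheory GRing.Theory Num.Theory.
Local Open Scope ring_scope.

(* The ring Z[v, v^-1], as the subring of the field Q(v) of fractions of Z[v]
   made of the quotients p / v ^ m. *)
Notation Qv := {fraction {poly int}}.
Notation polyQv := (@tofrac {poly int}).

Definition is_laurent : {pred Qv} :=
  fun x => `[< exists pm : {poly int} * nat,
                 x * polyQv 'X ^+ pm.2 = polyQv pm.1 >].

Lemma polyQvX_neq0 m : polyQv 'X ^+ m != 0.
Proof. by rewrite expf_neq0 // tofrac_eq0 polyX_eq0. Qed.

Fact is_laurent_subring : subring_closed is_laurent.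
Proof.
split.
- by apply/asboolP; exists (1, 0%N); rewrite /= mulr1 rmorph1.
- move=> x y /asboolP[[p m] /= xE] /asboolP[[r k] /= yE]; apply/asboolP.
  exists (p * 'X^k - r * 'X^m, (m + k)%N) => /=.
  by rewrite rmorphB !rmorphM !rmorphXn /= -xE -yE exprD mulrBl !mulrA
     [y * _ * _]mulrAC.
- move=> x y /asboolP[[p m] /= xE] /asboolP[[r k] /= yE]; apply/asboolP.
  by exists (p * r, (m + k)%N); rewrite /= rmorphM /= -xE -yE exprD mulrACA.
Qed.
HB.instance Definition _ :=
  GRing.isSubringClosed.Build Qv is_laurent is_laurent_subring.

Record laurent : Type := Laurent { lval :> Qv; _ : is_laurent lval }.
HB.instance Definition _ := [isSub for lval].
HB.instance Definition _ := [Choice of laurent by <:].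
HB.instance Definition _ := [SubChoice_isSubComNzRing of laurent by <:].

Lemma lvalM (x y : laurent) : lval (x * y) = lval x * lval y.
Proof. exact: (rmorphM val). Qed.

Lemma lval1 : lval 1 = 1.
Proof. exact: (rmorph1 val). Qed.

Lemma lval0 : lval 0 = 0.
Proof. exact: (raddf0 val). Qed.

Lemma lval_eq0 (x : laurent) : (lval x == 0) = (x == 0).
Proof. by rewrite -lval0; exact: (inj_eq val_inj). Qed.

Definition laurent_unit : {pred laurent} :=
  fun x => (x != 0) && ((lval x)^-1 \in is_laurent).
Definition laurent_inv (x : laurent) : laurent := insubd x (lval x)^-1.

Fact laurent_mulVx : {in laurent_unit, left_inverse 1 laurent_inv *%R}.
Proof.
move=> x /andP[x0 xV]; apply: val_inj; change (lval (laurent_inv x * x) = lval 1).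
rewrite lvalM lval1 (_ : lval (laurent_inv x) = (lval x)^-1); last exact: insubdK.
by rewrite -lval_eq0 in x0; rewrite mulVf.
Qed.

Fact laurent_unitPl (x y : laurent) : y * x = 1 -> laurent_unit x.
Proof.
move=> yx1; have yxE : lval y * lval x = 1 by rewrite -lvalM yx1 lval1.
have x0 : lval x != 0.
  by apply: contra_eq_neq yxE => ->; rewrite mulr0 eq_sym oner_neq0.
apply/andP; split; first by rewrite -lval_eq0.
suff -> : (lval x)^-1 = lval y by exact: (valP y).
by apply: (mulIf x0); rewrite mulVf.
Qed.

Fact laurent_inv_out : {in [predC laurent_unit], laurent_inv =1 id}.
Proof.
move=> x xN; have {}xN : ~~ laurent_unit x by [].
apply: val_inj; rewrite val_insubd; case: ifPn => // xV.
have [x0|x0] := eqVneq x 0; first by rewrite x0 (_ : lval 0 = 0) ?invr0 ?lval0.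
by case/negP: xN; apply/andP.
Qed.
HB.instance Definition _ :=
  GRing.ComNzRing_hasMulInverse.Build laurent
    laurent_mulVx laurent_unitPl laurent_inv_out.

Fact laurent_mulf_eq0 (x y : laurent) : x * y = 0 -> (x == 0) || (y == 0).
Proof.
by move=> /(congr1 lval)/eqP; rewrite lvalM lval0 mulf_eq0 !lval_eq0.
Qed.
HB.instance Definition _ :=
  GRing.ComUnitRing_isIntegral.Build laurent laurent_mulf_eq0.

Fact v_laurent : polyQv 'X \in is_laurent.
Proof. by apply/asboolP; exists ('X, 0%N); rewrite /= mulr1. Qed.

Definition v : laurent := Laurent v_laurent.
Definition q : laurent := v ^- 2.
Definition alpha : laurent := v^-1 - v.

Lemma v_unit : v \is a GRing.unit.
Proof.
have X0 : polyQv 'X != 0 by rewrite -(expr1 (polyQv 'X)) polyQvX_neq0.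
have vV : (polyQv 'X)^-1 \in is_laurent.
  by apply/asboolP; exists (1, 1%N); rewrite expr1 mulVf ?tofrac1.
by apply/unitrP; exists (Laurent vV); split; apply: val_inj;
  [change (lval (Laurent vV * v) = lval 1)|change (lval (v * Laurent vV) = lval 1)];
  rewrite lvalM lval1 /= ?mulVf ?divff.
Qed.

(* The involution d : v |-> v^-1, computed on x = p / v ^ m as
   p(v^-1) * v ^ m for some such p and m. *)
Definition lconj (x : laurent) : laurent :=
  let pm := xget (0, 0%N)
    [set pm | lval x * polyQv 'X ^+ pm.2 = polyQv pm.1]%classic in
  (map_poly intr pm.1).[v^-1] * v ^+ pm.2.

Lemma lconj_aux (L : comUnitRingType) (u a b : L) k m : u \is a GRing.unit ->
  a * u^-1 ^+ k = b * u^-1 ^+ m -> b * u ^+ k = a * u ^+ m.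
Proof.
move=> uU E; have uX j : u ^+ j \is a GRing.unit by rewrite unitrX.
have uK j : u^-1 ^+ j * u ^+ j = 1 by rewrite -exprMn mulVr // expr1n.
have := congr1 (fun z => z * (u ^+ k * u ^+ m)) E.
by rewrite mulrA -(mulrA a) uK mulr1 [u ^+ k * _]mulrC mulrA -(mulrA b) uK mulr1.
Qed.

Lemma lconjE (x : laurent) p m :
  lval x * polyQv 'X ^+ m = polyQv p ->
  lconj x = (map_poly intr p).[v^-1] * v ^+ m.
Proof.
move=> xE; rewrite /lconj; set P := (X in xget _ X).
have : P (xget (0, 0%N) P) by apply: xgetPex; exists (p, m).
move: (xget _ P) => [r k]; rewrite /P /= => {P} xE'.
have prE : p * 'X^k = r * 'X^m.
  apply/eqP; rewrite -tofrac_eq !tofracM !tofracXn -xE -xE'.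
  by rewrite mulrAC.
have := congr1 (horner_eval v^-1 \o map_poly (intr : int -> laurent)) prE.
rewrite !rmorphM !rmorphXn /= map_polyX /horner_eval hornerX.
exact: lconj_aux v_unit.
Qed.

Lemma lvalB (x y : laurent) : lval (x - y) = lval x - lval y.
Proof. exact: (raddfB val). Qed.

Lemma laurentP (x : laurent) :
  exists p, exists m, lval x * polyQv 'X ^+ m = polyQv p.
Proof. by have /asboolP[[p m] xE] := valP x; exists p, m. Qed.

Fact lconj_zmod_morphism : zmod_morphism lconj.
Proof.
move=> x y; have [p [m xE]] := laurentP x; have [r [k yE]] := laurentP y.
have vK j : v^-1 ^+ j * v ^+ j = 1 by rewrite -exprMn mulVr ?v_unit // expr1n.
rewrite (lconjE xE) (lconjE yE) (@lconjE _ (p * 'X^k - r * 'X^m) (m + k)).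
  rewrite rmorphB 2!rmorphM !rmorphXn /= map_polyX hornerD hornerN !hornerM.
  rewrite !hornerXn exprD mulrBl; congr (_ - _); last first.
    by rewrite mulrA -(mulrA _ (v^-1 ^+ m)) vK mulr1.
  by rewrite [v ^+ m * _]mulrC mulrA -(mulrA _ (v^-1 ^+ k)) vK mulr1.
by rewrite lvalB tofracB !tofracM !tofracXn -xE -yE exprD mulrBl !mulrA
     [lval y * _ * _]mulrAC.
Qed.

Fact lconj_monoid_morphism : monoid_morphism lconj.
Proof.
split.
  by rewrite (@lconjE _ 1 0) ?rmorph1 ?hornerC ?mulr1 // lval1 mulr1 tofrac1.
move=> x y; have [p [m xE]] := laurentP x; have [r [k yE]] := laurentP y.
rewrite (lconjE xE) (lconjE yE) (@lconjE _ (p * r) (m + k)).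
  by rewrite rmorphM hornerM exprD mulrACA.
by rewrite lvalM tofracM -xE -yE exprD mulrACA.
Qed.
HB.instance Definition _ :=
  GRing.isZmodMorphism.Build laurent laurent lconj lconj_zmod_morphism.
HB.instance Definition _ :=
  GRing.isMonoidMorphism.Build laurent laurent lconj lconj_monoid_morphism.

Lemma lconj_v : lconj v = v^-1.
Proof.
rewrite (@lconjE _ 'X 0); first by rewrite map_polyX hornerX mulr1.
by rewrite mulr1.
Qed.

Section Coxeter.
Variables (W : finGroupType) (S : {set W}).

(* S ^+ k is the set of products of k elements of S. *)
Definition ell (w : W) : nat :=
  find (fun k => w \in (S ^+ k)%g) (iota 0 #|W|).

Definition reflections : {set W} := class_support S [set: W].

Definition bruhat_step : rel W :=
  fun x y => (ell x < ell y)%N && [exists t in reflections, y == (t * x)%g].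

Definition bruhat : rel W := connect bruhat_step.

Definition bruhat_lt : rel W := fun x y => (x != y) && bruhat x y.

Definition bruhat_is_sup (A : {set W}) (w : W) : bool :=
  [forall x in A, bruhat x w] &&
  [forall y, [forall x in A, bruhat x y] ==> bruhat w y].

(* The supremum of A, or 1 if there is none. *)
Definition bruhat_sup (A : {set W}) : W :=
  odflt 1%g [pick w | bruhat_is_sup A w].

Definition longest (J : {set W}) : W := [arg max_(w > 1%g in <<J>>%g) ell w].

Variable H : unitAlgType laurent.
Implicit Types b h c : W -> H.

Definition is_basis b : Prop :=
  forall x : H, exists! a : {ffun W -> laurent}, x = \sum_w a w *: b w.

(* For a basis b, the linear form dual b s is the element of the basis dual to
   b that takes the value 1 at b s; dual b s x is its pairing with x. *)
Definition dual b (s : W) : H -> laurent := fun x =>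
  xget [ffun=> 0] [set a : {ffun W -> laurent} | x = \sum_w a w *: b w]%classic s.

Definition is_hecke h : Prop :=
  [/\ is_basis h,
      forall w1 w2, (ell w1 + ell w2 = ell (w1 * w2)%g)%N ->
        h w1 * h w2 = h (w1 * w2)%g &
      forall s, s \in S -> (h s + v%:A) * (h s - (v^-1)%:A) = 0].

(* The involution of H that is semilinear with respect to lconj and maps h w
   to the inverse of h w^-1. *)
Definition bar h (x : H) : H := \sum_w lconj (dual h w x) *: (h (w^-1)%g)^-1.

Definition in_vZv (x : laurent) : Prop :=
  exists p : {poly int}, lval x = polyQv ('X * p).

Definition is_KL_basis h c : Prop :=
  [/\ is_basis c,
      forall w, bar h (c w) = c w,
      forall w, dual h w (c w) = 1 &
      forall s w, s != w -> in_vZv (dual h s (c w))].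

Definition KLpoly h c (s w : W) : laurent :=
  v ^ ((ell s)%:Z - (ell w)%:Z) * dual h s (c w).

(* fbasis h tau w is f_{w,tau}. *)
Definition fbasis h (tau w : W) : H := (h tau)^-1 * h (tau * w)%g.

Definition Rpoly h (J : {set W}) (s w : W) : laurent :=
  v ^ ((ell s)%:Z - (ell w)%:Z)
    * dual (fbasis h (longest S * longest J)%g) s (h w).

(* Exact division in Z[v, v^-1]: the quotient, computed in Q(v), when it lies in
   Z[v, v^-1], and 0 otherwise. *)
Definition ldiv (x y : laurent) : laurent := insubd 0 (lval x / lval y).

Definition Icheck h c (tau s w : W) : laurent :=
  ldiv ((dual (fbasis h tau) s \- dual h s) (c w)) alpha.

Definition Qpoly h c (J : {set W}) (s w : W) : laurent :=
  v ^ ((ell s)%:Z - (ell w)%:Z + 1)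
    * lconj (Icheck h c (longest S * longest J)%g s w).

End Coxeter.

(* The symmetric group on 'I_n, with permutations composed right to left; the
   product of MathComp's 'S_n is the opposite one. *)
Definition sym (n : nat) : Type := {perm 'I_n}.
HB.instance Definition _ n := Finite.on (sym n).

Definition sym_mul n (s t : sym n) : sym n := perm.perm_mul t s.

Fact sym_mulA n : associative (@sym_mul n).
Proof. by move=> s t u; exact: (esym (@mulgA {perm 'I_n} u t s)). Qed.

Fact sym_mul1 n : left_id (perm_one 'I_n : sym n) (@sym_mul n).
Proof. exact: (@mulg1 {perm 'I_n}). Qed.

Fact sym_mulV n :
  left_inverse (perm_one 'I_n : sym n) (@perm_inv 'I_n) (@sym_mul n).
Proof. exact: (@mulgV {perm 'I_n}). Qed.
HB.instance Definition _ n :=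
  Finite_isGroup.Build (sym n) (@sym_mulA n) (@sym_mul1 n) (@sym_mulV n).

Definition sym_fun n (s : sym n) : 'I_n -> 'I_n := fun i => (s : {perm 'I_n}) i.

Lemma sym_funM n (s t : sym n) i : sym_fun (s * t)%g i = sym_fun s (sym_fun t i).
Proof. exact: permM. Qed.

Definition transp n (i j : 'I_n) : sym n := tperm i j.

(* The letters 1, ..., n+1 permuted by S_{n+1} are represented by 0, ..., n. *)
Definition simple_transp n (i : 'I_n) : sym n.+1 :=
  transp (widen_ord (leqnSn n) i) (lift ord0 i).

Definition simples n : {set sym n.+1} := [set simple_transp i | i : 'I_n].

Definition Jset n : {set sym n.+1} :=
  [set simple_transp i | i : 'I_n & (i.+1 < n)%N].

Definition last_transp n (i : 'I_n) : sym n.+1 :=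
  transp (widen_ord (leqnSn n) i) ord_max.

Section Hypercube.
Variable n : nat.
Implicit Types (s w : sym n.+1) (B : {set 'I_n}).
Notation S := (simples n).

Definition cube s B : {set sym n.+1} := [set (last_transp i * s)%g | i in B].

Definition Pset s w : {set {set 'I_n}} :=
  [set B : {set 'I_n} |
    [forall i in B, bruhat_lt S s (last_transp i * s)%g] &&
    bruhat_is_sup S (s |: cube s B) w].

Definition Dset s : {set 'I_n} :=
  [set i | bruhat_lt S s (last_transp i * s)%g].

End Hypercube.

(* Main.v *)
(* Here w_0 w_0^J = s_0 s_1 ... s_(n-1) is a Coxeter element c (letters 0..n), so
   R_(z,w,J) is, up to a power of v, the coefficient of h_(cz) in
   h_(s_0) ... h_(s_(n-1)) h_w.  Letting the factors s_0, s_1, ... act in turn on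
   dual basis elements, the k-th one branches exactly when z^-1(k) < z^-1(n), and
   then either keeps z or replaces it by (k, n) z.  The sum over the subsets B
   obeys the same recursion, because the rank function of the supremum of z and
   the (i, n) z, i in B, is the pointwise maximum of theirs, so that for k the
   least element of B it is also the supremum attached to (k, n) z and to B
   without k.  The formula for Q follows by expanding the Kazhdan-Lusztig element
   in the basis h; only the fact that h is a basis is used there. *)
Require Import Defs.
From mathcomp Require Import all_boot all_order all_fingroup all_algebra.
From mathcomp Require Import boolp.
From mathcomp Require Import zify.
Set Implicit Arguments.
Unset Strict Implicit.
Unset Printing Implicit Defensive.

(** * Length, reflections and Bruhat order of the symmetric group, read off from the places of
    letters *)

Section Perm.
Variable n : nat.
Implicit Types (w x y z : sym n.+1) (i j k : 'I_n.+1).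
Local Notation S := (simples n).

(** The place of the letter [i] in the one-line notation of [w]; left multiplication by a
    transposition swaps the places of two letters. *)
Definition pos w i : 'I_n.+1 := sym_fun (w^-1)%g i.

Lemma symP x y : sym_fun x =1 sym_fun y -> x = y.
Proof. by move=> E; apply/permP. Qed.

Lemma sym_fun1 i : sym_fun 1%g i = i.
Proof. exact: perm1. Qed.

Lemma pos1 i : pos 1%g i = i.
Proof. by rewrite /pos invg1 sym_fun1. Qed.

Lemma posM x y i : pos (x * y)%g i = pos y (pos x i).
Proof. by rewrite /pos invMg sym_funM. Qed.

Lemma pos_funK x : cancel (sym_fun x) (pos x).
Proof. by move=> i; rewrite /pos -sym_funM mulVg sym_fun1. Qed.

Lemma fun_posK x : cancel (pos x) (sym_fun x).
Proof. by move=> i; rewrite /pos -sym_funM mulgV sym_fun1. Qed.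

Lemma pos_inj x : injective (pos x).
Proof. exact: can_inj (fun_posK x). Qed.

Lemma posP x y : pos x =1 pos y -> x = y.
Proof. by move=> E; apply: invg_inj; apply: symP => i; apply: E. Qed.

Lemma transpK i j : (transp i j * transp i j = 1)%g.
Proof. by apply: symP => k; rewrite sym_funM sym_fun1; apply: tpermK. Qed.

Lemma transpV i j : ((transp i j)^-1 = transp i j)%g.
Proof. by apply: (mulgI (transp i j)); rewrite mulgV transpK. Qed.

Lemma transpKg i j w : (transp i j * (transp i j * w) = w)%g.
Proof. by rewrite mulgA transpK mul1g. Qed.

Lemma pos_transp i j k : pos (transp i j) k = tperm i j k.
Proof. by rewrite /pos transpV. Qed.

Lemma pos_transpM i j w k : pos (transp i j * w)%g k = pos w (tperm i j k).
Proof. by rewrite posM pos_transp. Qed.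

Lemma transpC i j : transp i j = transp j i.
Proof. by rewrite /transp tpermC. Qed.

Lemma val_tperm i j k :
  tperm i j k =
    (if k == i :> nat then nat_of_ord j else if k == j :> nat then nat_of_ord i
     else nat_of_ord k) :> nat.
Proof.
rewrite !val_eqE; case: tpermP => [->|->|/eqP/negPf-> /eqP/negPf->//].
  by rewrite eqxx.
by rewrite eqxx; case: eqP => [->|].
Qed.

Lemma pos_eqE w i j : (pos w i == pos w j :> nat) = (i == j :> nat).
Proof. by rewrite !val_eqE (inj_eq (@pos_inj w)). Qed.

Lemma widenE (k : 'I_n) : widen_ord (leqnSn n) k = k :> nat.
Proof. by []. Qed.

Lemma liftE (k : 'I_n) : lift ord0 k = k.+1 :> nat.
Proof. by rewrite lift0. Qed.

Lemma transp_conj i j x : (x * transp i j * x^-1 = transp (sym_fun x i) (sym_fun x j))%g.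
Proof.
apply: (canLR (mulgK _)); apply: symP => k; rewrite !sym_funM.
rewrite /transp /sym_fun.
have inj : injective ((x : {perm _}) : 'I_n.+1 -> 'I_n.+1) by apply: perm_inj.
by rewrite -(inj_tperm i j k inj).
Qed.

(* Inversions are counted as pairs of values, so that left multiplication by a
   simple transposition only permutes the index pairs. *)
Definition inv w : nat :=
  \sum_(ij : 'I_n.+1 * 'I_n.+1) ((ij.1 < ij.2) && (pos w ij.2 < pos w ij.1))%N.

Lemma inv_adjacent_up (a b : 'I_n.+1) w : b = a.+1 :> nat ->
  pos w a < pos w b -> inv (transp a b * w)%g = (inv w).+1.
Proof.
move=> bE lt_ab; rewrite /inv.
have tK : involutive (tperm a b) by exact: tpermK.
rewrite (reindex (fun ij => (tperm a b ij.1, tperm a b ij.2))) /=; last first.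
  by exists (fun ij => (tperm a b ij.1, tperm a b ij.2)) => -[i j] _ /=; rewrite !tK.
(* Swapping the adjacent letters [a] and [b] changes the order of no other pair of letters, so (b,
   a) is the only inversion gained. *)
transitivity (\sum_(ij : 'I_n.+1 * 'I_n.+1)
   (((ij.1 < ij.2) && (pos w ij.2 < pos w ij.1)) + (ij == (b, a)))); last first.
  rewrite big_split /= -[RHS]addn1; congr addn.
  by rewrite (bigD1 (b, a)) //= eqxx big1 // => ij /negPf->.
apply: eq_bigr => -[i j] _ /=.
rewrite !pos_transpM !tK xpair_eqE !val_tperm -!val_eqE /=.
have eqO (c d : 'I_n.+1) : (c == d :> nat) -> c = d by move/eqP/val_inj.
by do ![case: ifP => [/eqO ?|?]]; subst; lia.
Qed.

Lemma inv_adjacent_down (a b : 'I_n.+1) w : b = a.+1 :> nat ->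
  pos w b < pos w a -> inv w = (inv (transp a b * w)%g).+1.
Proof.
move=> bE lt_ba; rewrite -(@inv_adjacent_up a b) // ?transpKg //.
by rewrite !pos_transpM tpermL tpermR.
Qed.

Lemma simplesP x :
  reflect (exists a b : 'I_n.+1, b = a.+1 :> nat /\ x = transp a b) (x \in S).
Proof.
apply: (iffP imsetP) => [[k _ ->]|[a [b [bE ->]]]].
  by exists (widen_ord (leqnSn n) k), (lift ord0 k); rewrite liftE.
have a_lt : a < n by have := ltn_ord b; rewrite bE ltnS.
exists (Ordinal a_lt) => //; rewrite /simple_transp.
by congr transp; apply: val_inj; rewrite /= ?liftE.
Qed.

Lemma mem_simples (a b : 'I_n.+1) : b = a.+1 :> nat -> transp a b \in S.
Proof. by move=> bE; apply/simplesP; exists a, b. Qed.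

Lemma leq_gap (f : nat -> nat) (i j : nat) :
  (forall k : nat, i <= k < i + j -> f k < f k.+1) -> f i + j <= f (i + j).
Proof.
elim: j => [|j IH] inc; first by rewrite !addn0.
have inc_j : f (i + j) < f (i + j).+1 by apply: inc; lia.
have le_j : f i + j <= f (i + j) by apply: IH => k lt_k; apply: inc; lia.
by rewrite !addnS; lia.
Qed.

(** Without an adjacent descent [pos w] would be strictly increasing from 0, ..., n to itself; the
    gaps before and after each [i] then force it to fix [i]. *)
Lemma adjacent_descent w : w != 1%g ->
  exists a b : 'I_n.+1, b = a.+1 :> nat /\ pos w b < pos w a.
Proof.
move=> w_neq1; apply: contrapT => no_desc; case/eqP: w_neq1.
pose f (k : nat) : nat := pos w (inord k).
have inc (k : nat) : k < n -> f k < f k.+1.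
  move=> lt_kn; rewrite ltn_neqAle /f pos_eqE !inordK ?ltnS ?(ltnW lt_kn) //.
  rewrite neq_ltn ltnSn /= leqNgt; apply/negP => lt; apply: no_desc.
  by exists (inord k), (inord k.+1); rewrite !inordK ?ltnS ?(ltnW lt_kn).
apply: posP => i; rewrite pos1; apply: val_inj => /=.
have fi : pos w i = f i :> nat by rewrite /f inord_val.
have le_in : i <= n by rewrite -ltnS.
have gap0 : f 0 + i <= f (0 + i) by apply: leq_gap => k lt; apply: inc; lia.
have gap1 : f i + (n - i) <= f (i + (n - i)).
  by apply: leq_gap => k lt; apply: inc; lia.
have fn : f (i + (n - i)) <= n by rewrite -ltnS ltn_ord.
by move: gap0; rewrite add0n fi; lia.
Qed.

Lemma inv1 : inv 1%g = 0.
Proof. by rewrite /inv big1 // => ij _; rewrite !pos1; lia. Qed.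

Lemma mem_expgS_inv w : (w \in S ^+ inv w)%g.
Proof.
have [m] := ubnP (inv w); elim: m w => // m IH w.
have [->|/adjacent_descent[a [b [bE lt_ba]]]] := eqVneq w 1%g.
  by rewrite inv1 expg0 group1.
rewrite (inv_adjacent_down bE lt_ba) ltnS => /IH w'_in.
by rewrite expgS -{1}(transpKg a b w) mem_mulg ?mem_simples.
Qed.

Lemma inv_leq_expgS (k : nat) w : (w \in S ^+ k)%g -> inv w <= k.
Proof.
elim: k w => [|k IH] w; first by rewrite expg0 => /set1P->; rewrite inv1.
rewrite expgS => /mulsgP[_ w' /simplesP[a [b [bE ->]]] /IH le_k ->].
have := ltngtP (pos w' a) (pos w' b) => -[lt|lt|/eqP].
- by rewrite inv_adjacent_up.
- by apply: leq_trans (leqW le_k); rewrite (inv_adjacent_down bE lt).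
- by rewrite pos_eqE; lia.
Qed.

(** [ell] tries only exponents below the order of the group, and this bound puts [inv w] among them.
    Adjacent descents starting from [w] meet every smaller inversion number, each at a new
    element. *)
Lemma inv_ltn_card w : inv w < #|{: sym n.+1}|.
Proof.
suff: forall m w, inv w = m -> m < #|[set x : sym n.+1 | inv x <= m]|.
  by move=> /(_ _ w erefl) /leq_trans; apply; apply: max_card.
elim=> [|m IH] {}w wE.
  by rewrite card_gt0; apply/set0Pn; exists w; rewrite inE wE.
have w_neq1 : w != 1%g by apply: contra_eq_neq wE => ->; rewrite inv1.
have [a [b [bE lt_ba]]] := adjacent_descent w_neq1.
have w'E : inv (transp a b * w)%g = m.
  by have := inv_adjacent_down bE lt_ba; rewrite wE => -[].
apply: leq_ltn_trans (IH _ w'E) _.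
apply/proper_card/properP; split; last by exists w; rewrite inE wE // ltnn.
by apply/subsetP => x; rewrite !inE => /leqW.
Qed.

(** Some word of [inv w] simple transpositions gives [w], and no shorter one can, because each
    factor adds at most one inversion. *)
Lemma ellE w : ell S w = inv w.
Proof.
rewrite /ell; set P := fun k : nat => _; have lt_w := inv_ltn_card w.
have Pw : has P (iota 0 #|{: sym n.+1}|).
  by apply/hasP; exists (inv w); rewrite ?mem_iota //; apply: mem_expgS_inv.
have lt_f := Pw; rewrite has_find size_iota in lt_f.
apply/eqP; rewrite eqn_leq; apply/andP; split; last first.
  by have := nth_find 0 Pw; rewrite nth_iota // => /inv_leq_expgS.
rewrite leqNgt; apply/negP => /(before_find 0).
by rewrite nth_iota // /P mem_expgS_inv.
Qed.

Local Notation ell := (ell S).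

Lemma ell_adjacent_up (a b : 'I_n.+1) w : b = a.+1 :> nat ->
  pos w a < pos w b -> ell (transp a b * w)%g = (ell w).+1.
Proof. by rewrite !ellE; apply: inv_adjacent_up. Qed.

Lemma ell_adjacent_down (a b : 'I_n.+1) w : b = a.+1 :> nat ->
  pos w b < pos w a -> ell w = (ell (transp a b * w)%g).+1.
Proof. by rewrite !ellE; apply: inv_adjacent_down. Qed.

(** Induction on [d - c] with e = d - 1 and (c d) = (e d)(c e)(e d). The middle factor raises the
    length by induction, and the outer ones change it by one each. They do not both lower it: if the
    first does, the place of [d] lies between those of [c] and [e], and then the last one raises
    it. *)
Lemma ell_transp_up (c d : 'I_n.+1) w : c < d -> pos w c < pos w d ->
  ell w < ell (transp c d * w)%g.
Proof.
have [m] := ubnP (d - c); elim: m d w => // m IH d w lt_m lt_cd lt_w.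
have [dE|d_neq] := eqVneq (d : nat) c.+1.
  by rewrite (ell_adjacent_up dE lt_w).
have e_lt : d.-1 < n.+1 by have := ltn_ord d; lia.
pose e := Ordinal e_lt; have dE : d = e.+1 :> nat by rewrite /=; lia.
have tE : (transp c d * w = transp e d * (transp c e * (transp e d * w)))%g.
  have -> : transp c d = (transp e d * transp c e * (transp e d)^-1)%g.
    rewrite transp_conj; congr transp; rewrite /transp /sym_fun ?tpermL //.
    by rewrite tpermD // -val_eqE /=; lia.
  by rewrite transpV !mulgA.
have ed_c : tperm e d c = c by rewrite tpermD // -val_eqE /=; lia.
have ce_d : tperm c e d = d by rewrite tpermD // -val_eqE /=; lia.
have ltc : c < e by rewrite /=; lia.
have {}IH := IH e (transp e d * w)%g _ ltc.
rewrite !pos_transpM tpermL ed_c in IH.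
have {}IH : ell (transp e d * w)%g < ell (transp c e * (transp e d * w))%g.
  by apply: IH => //=; lia.
rewrite tE; case: (ltngtP (pos w e) (pos w d)) => [lt|lt|/eqP].
- have := ell_adjacent_up dE lt.
  have := ltngtP (pos (transp c e * (transp e d * w))%g e)
                (pos (transp c e * (transp e d * w))%g d) => -[lt'|lt'|/eqP].
  + by have := ell_adjacent_up dE lt'; lia.
  + by have := ell_adjacent_down dE lt'; lia.
  + by rewrite pos_eqE; lia.
- have := ell_adjacent_down dE lt.
  have := @ell_adjacent_up e d (transp c e * (transp e d * w))%g dE.
  rewrite !pos_transpM tpermR ed_c ce_d tpermR => /(_ (ltn_trans lt_w lt)).
  by lia.
- by rewrite pos_eqE; lia.
Qed.

Lemma ell_transp (c d : 'I_n.+1) w : c < d ->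
  (ell w < ell (transp c d * w)%g) = (pos w c < pos w d).
Proof.
move=> lt_cd; apply/idP/idP; last exact: ell_transp_up.
apply: contraLR; rewrite -!leqNgt leq_eqVlt pos_eqE => /orP[|lt_w]; first by lia.
apply: ltnW; rewrite -{2}(transpKg c d w); apply: ell_transp_up => //.
by rewrite !pos_transpM tpermL tpermR.
Qed.

Lemma reflectionsP x :
  reflect (exists c d : 'I_n.+1, c < d /\ x = transp c d) (x \in reflections S).
Proof.
apply: (iffP imset2P) => [[s y /simplesP[a [b [bE ->]]] _ ->]|[c [d [lt_cd ->]]]].
  rewrite conjgE mulgA -{2}[y]invgK transp_conj.
  set c := sym_fun _ a; set d := sym_fun _ b.
  have neq_cd : c != d.
    apply: contra_eq_neq bE => /(can_inj (pos_funK _)) <-; lia.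
  have [lt|lt|/val_inj/eqP] := ltngtP c d; first by exists c, d.
    by exists d, c; rewrite transpC.
  by rewrite (negPf neq_cd).
(* (c d) is the conjugate of the simple transposition (c, c+1) by (c+1, d), which is the identity
   when d = c+1. *)
have b_lt : c.+1 < n.+1 by have := ltn_ord d; lia.
pose b := Ordinal b_lt; have bE : b = c.+1 :> nat by [].
exists (transp c b) (transp b d)^-1%g; rewrite ?mem_simples ?inE //.
rewrite conjgE mulgA invgK transp_conj /transp /sym_fun; congr tperm.
  by rewrite tpermD // -val_eqE /=; lia.
by rewrite tpermL.
Qed.

Local Notation bruhat := (bruhat S).

Lemma bruhat_refl x : bruhat x x.
Proof. exact: connect0. Qed.

Lemma bruhat_trans y x z : bruhat x y -> bruhat y z -> bruhat x z.
Proof. exact: connect_trans. Qed.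

Lemma bruhat_transp (c d : 'I_n.+1) w : c < d -> pos w c < pos w d ->
  bruhat w (transp c d * w)%g.
Proof.
move=> lt_cd lt_w; apply: connect1; rewrite /bruhat_step ell_transp_up //=.
by apply/existsP; exists (transp c d); rewrite eqxx andbT; apply/reflectionsP; exists c, d.
Qed.

(** The rank function of the tableau criterion: by [bruhatP], its pointwise comparison is the Bruhat
    order. *)
Definition rank w (a b : nat) : nat :=
  \sum_(i : 'I_n.+1) ((b <= i) && (pos w i < a)).

(** Only [c] and [d] trade places, and the larger letter now comes first. The count sees this
    exactly when the cut [a] separates the two places and the cut [b] the two letters. *)
Lemma rank_transp (c d : 'I_n.+1) w a b : c < d -> pos w c < pos w d ->
  rank (transp c d * w)%g a b =
  rank w a b + [&& pos w c < a, a <= pos w d, c < b & b <= d].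
Proof.
move=> lt_cd lt_w; have dc : d != c by rewrite -val_eqE /=; lia.
rewrite /rank (bigD1 c) // (bigD1 d) //= [in RHS](bigD1 c) // [in RHS](bigD1 d) //=.
rewrite !pos_transpM tpermL tpermR.
rewrite (eq_bigr (fun i : 'I_n.+1 => ((b <= i) && (pos w i < a) : nat))); last first.
  by move=> i /andP[ic id]; rewrite pos_transpM tpermD // eq_sym.
by lia.
Qed.

Lemma bruhat_rank x y a b : bruhat x y -> rank x a b <= rank y a b.
Proof.
case/connectP => p + ->; elim: p x => //= z p IH x /andP[+ /IH].
case/andP => lt_ell /exists_inP[t /reflectionsP[c [d [lt_cd ->]]] /eqP zE].
rewrite {}zE ell_transp // in lt_ell *.
by apply: leq_trans; rewrite rank_transp // leq_addr.
Qed.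

Lemma bruhat_ell x y : bruhat x y -> x = y \/ ell x < ell y.
Proof.
case/connectP => p + ->; elim: p x => [|z p IH] x /=; first by left.
case/andP => /andP[lt_xz _] /IH[<-|]; first by right.
by move=> lt_z; right; apply: ltn_trans lt_z.
Qed.

Lemma bruhat_anti x y : bruhat x y -> bruhat y x -> x = y.
Proof. by move=> /bruhat_ell[//|lt1] /bruhat_ell[//|lt2]; lia. Qed.

(* One step of the tableau criterion: x is moved towards y by exchanging the
   largest value c at which they differ with the largest smaller value e that
   lies weakly to the right of the place of c in y. *)
Lemma rank_step x y : x != y -> (forall a b, rank x a b <= rank y a b) ->
  exists e c : 'I_n.+1, [/\ e < c, pos x e < pos x c &
    forall a b, rank (transp e c * x)%g a b <= rank y a b].
Proof.
move=> x_neq_y le_xy.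
have [c0 c0P] : exists c, pos x c != pos y c.
  apply/existsP; move: x_neq_y; apply: contraR => /existsPn E.
  by apply/eqP/posP => i; have /negbNE/eqP := E i.
case: (@arg_maxnP _ c0 (fun c => pos x c != pos y c) val c0P) => c c_neq c_max.
have agree i : c < i -> pos x i = pos y i.
  move=> lt_ci; apply: contraTeq lt_ci => i_neq; rewrite -leqNgt.
  exact: c_max.
have lt_c : pos y c < pos x c.
  rewrite ltn_neqAle val_eqE eq_sym c_neq /= leqNgt; apply/negP => lt.
  have := le_xy (pos y c) c; rewrite leqNgt => /negP; apply.
  rewrite /rank (bigD1 c) //= [X in _ < X](bigD1 c) //= lt leqnn ltnn /=.
  rewrite add0n add1n ltnS; apply: leq_sum => i ic.
  have [ci|] := boolP (c <= i) => //=.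
  by rewrite agree // ltn_neqAle eq_sym val_eqE ic.
pose P (e : 'I_n.+1) := [&& e < c, pos y c <= pos x e & pos x e < pos x c].
have e0P : P (sym_fun x (pos y c)).
  rewrite /P pos_funK leqnn lt_c !andbT ltnNge leq_eqVlt.
  apply/negP => /orP[/eqP/val_inj cE|lt].
    by move: lt_c; rewrite {2}cE pos_funK ltnn.
  by have := agree _ lt; rewrite pos_funK => /pos_inj cE; move: lt; rewrite -cE ltnn.
case: (@arg_maxnP _ _ P val e0P) => e /and3P[lt_ec le_e lt_e] e_max.
exists e, c; split=> // a b; rewrite rank_transp //.
have [/and4P[lt_ea le_ac lt_eb le_bc]|_] := boolP [&& _, _, _ & _]; last first.
  by rewrite addn0 le_xy.
have between (i : 'I_n.+1) : e < i -> i < c -> pos x i < a -> pos x i < pos y c.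
  move=> lt_ei lt_ic lt_ia; rewrite ltnNge; apply/negP => le_i.
  have : i <= e by apply: e_max; rewrite /P lt_ic le_i (leq_trans lt_ia).
  by rewrite leqNgt lt_ei.
(* Compare the letters at least [b] at places from [pos y c] up to [a]: [y] has [c] there and [x]
   does not, above [c] both agree, and by the choice of [e] no letter of [x] from [b] to c - 1 is
   there. With the ranks at [pos y c] this leaves room for the added one. *)
have : rank x a b + 1 + rank y (pos y c) b <= rank y a b + rank x (pos y c) b.
  have -> : 1 = \sum_(i : 'I_n.+1) (i == c).
    by rewrite (bigD1 c) //= eqxx big1 // => i /negPf->.
  rewrite /rank -!big_split /=; apply: leq_sum => i _.
  have [lt_ci|lt_ic|/val_inj ic] := ltngtP c i.
  - rewrite agree // (_ : i == c = false); last by rewrite -val_eqE /=; lia.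
    by lia.
  - have := between i; rewrite (_ : i == c = false); last by rewrite -val_eqE /=; lia.
    by lia.
  - by subst i; rewrite eqxx; lia.
by have := le_xy (pos y c) b; lia.
Qed.

Lemma ell_leq_card w : ell w <= #|{: sym n.+1}|.
Proof. by rewrite ellE ltnW // inv_ltn_card. Qed.

(** [rank_step] climbs from [x] in Bruhat order and keeps the rank below that of [y]. The length is
    bounded, so the climb ends, and it can only end at [y]. *)
Lemma bruhatP x y : reflect (forall a b, rank x a b <= rank y a b) (bruhat x y).
Proof.
apply: (iffP idP) => [le_xy a b|]; first exact: bruhat_rank.
have [m] := ubnP (#|{: sym n.+1}| - ell x); elim: m x => // m IH x lt_m le_xy.
have [->|/rank_step/(_ le_xy)] := eqVneq x y; first exact: bruhat_refl.
case=> [e [c [lt_ec lt_x le]]].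
apply: bruhat_trans (bruhat_transp lt_ec lt_x) (IH _ _ le).
have := ell_transp_up lt_ec lt_x; have := ell_leq_card (transp e c * x)%g.
by lia.
Qed.

Lemma rank_inj x y : (forall a b, rank x a b = rank y a b) -> x = y.
Proof. by move=> E; apply: bruhat_anti; apply/bruhatP => a b; rewrite E. Qed.
End Perm.

(** * Suprema of z and of elements (i, n) z above it *)

Section Jump.
Variable n : nat.
Implicit Types (w x y z : sym n.+1) (i j k : 'I_n) (B : {set 'I_n}).
Local Notation S := (simples n).
Local Notation ell := (ell S).
Local Notation bruhat := (bruhat S).

Definition wide i : 'I_n.+1 := widen_ord (leqnSn n) i.

Lemma last_transpE i : last_transp i = transp (wide i) ord_max.
Proof. by []. Qed.

Lemma wide_lt i : wide i < (ord_max : 'I_n.+1).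
Proof. exact: (ltn_ord i). Qed.

Definition ascent z i := pos z (wide i) < pos z ord_max.

Lemma bruhat_lt_last z i :
  bruhat_lt S z (last_transp i * z)%g = ascent z i.
Proof.
rewrite /ascent -(ell_transp z (wide_lt i)); apply/andP/idP => [[neq]|lt].
  by case/bruhat_ell => // zE; rewrite -zE eqxx in neq.
split; last by rewrite bruhat_transp ?wide_lt // -ell_transp ?wide_lt.
by apply: contraTneq lt => {1}->; rewrite last_transpE ltnn.
Qed.

(** The rectangle of [rank_transp] for the letters i and n; it is empty when [ascent z i] fails. *)
Definition in_rect z (a b : nat) i :=
  [&& pos z (wide i) < a, a <= pos z ord_max, i < b & b <= n].

(* jump z B w says that the rank function of w is the pointwise maximum of
   those of z and of the (i, n) z > z with i in B. *)
Definition jump z B w : Prop :=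
  forall a b, rank w a b = rank z a b + [exists i in B, in_rect z a b i].

Lemma rank_last z i a b : ascent z i ->
  rank (last_transp i * z)%g a b = rank z a b + in_rect z a b i.
Proof. by move=> zi; rewrite rank_transp ?wide_lt. Qed.

Lemma exists_setU1 (P : pred 'I_n) k B :
  [exists i in k |: B, P i] = P k || [exists i in B, P i].
Proof.
apply/exists_inP/orP => [[i /setU1P[->|iB] Pi]|[Pk|/exists_inP[i iB Pi]]].
- by left.
- by right; apply/exists_inP; exists i.
- by exists k; rewrite ?setU11.
- by exists i; rewrite ?setU1r.
Qed.

Lemma jump_setU1_descent z k B w : ~~ ascent z k ->
  jump z (k |: B) w <-> jump z B w.
Proof.
rewrite /ascent -leqNgt => le_k.
suff E a b : [exists i in k |: B, in_rect z a b i] = [exists i in B, in_rect z a b i].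
  by split=> J a b; rewrite J E.
by rewrite exists_setU1 (_ : in_rect z a b k = false) // /in_rect; lia.
Qed.

Lemma pos_last_wide z k i : i != k ->
  pos (last_transp k * z)%g (wide i) = pos z (wide i).
Proof.
by move=> ik; rewrite pos_transpM tpermD // -val_eqE /= 1?eq_sym // neq_ltn ltn_ord ?orbT.
Qed.

Lemma pos_last_max z k : pos (last_transp k * z)%g ord_max = pos z (wide k).
Proof. by rewrite pos_transpM tpermR. Qed.

(** In (k, n) z the letter n has the former place of k. As k < i, the rectangle of i there is its
    rectangle in z with the one of k removed, so the union with the rectangle of k is the same. *)
Lemma jump_setU1_ascent z k B w : ascent z k ->
  (forall i, i \in B -> k < i) ->
  jump z (k |: B) w <-> jump (last_transp k * z)%g B w.
Proof.
move=> zk lt_kB.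
suff E a b : rank (last_transp k * z)%g a b
    + [exists i in B, in_rect (last_transp k * z)%g a b i] =
  rank z a b + [exists i in k |: B, in_rect z a b i].
  by split=> J a b; rewrite J E.
rewrite rank_last // exists_setU1 -addnA; congr addn.
have -> : [exists i in B, in_rect (last_transp k * z)%g a b i] =
          [exists i in B, ~~ in_rect z a b k && in_rect z a b i].
  apply: eq_existsb => i; have [iB|//] := boolP (i \in B) => /=.
  have lt_ki := lt_kB _ iB; move: zk.
  rewrite /in_rect /ascent pos_last_wide ?pos_last_max; last by rewrite neq_ltn lt_ki orbT.
  by lia.
case: (in_rect z a b k) => //=.
by case: exists_inP => // -[].
Qed.

Lemma jump0 z : jump z set0 z.
Proof.
by move=> a b; case: exists_inP => [[i]|]; rewrite ?inE ?addn0.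
Qed.

Lemma jump_inj z B w w' : jump z B w -> jump z B w' -> w = w'.
Proof. by move=> J J'; apply: rank_inj => a b; rewrite J J'. Qed.

(** The least element of [B] is taken off first, as [jump_setU1_ascent] requires. *)
Lemma jump_ex z B : exists w, jump z B w.
Proof.
have [m] := ubnP #|B|; elim: m z B => // m IH z B lt_m.
have [->|[k0 k0B]] := set_0Vmem B; first by exists z; apply: jump0.
case: (@arg_minnP _ k0 [in B] val k0B) => k kB k_min.
rewrite -(setD1K kB); move: lt_m; rewrite (cardsD1 k) kB add1n ltnS => /IH{}IH.
have [zk|zk] := boolP (ascent z k); last first.
  by have [w J] := IH z; exists w; apply/jump_setU1_descent.
have [w J] := IH (last_transp k * z)%g; exists w; apply/jump_setU1_ascent => // i.
by case/setD1P => ik /k_min; rewrite leq_eqVlt eq_sym val_eqE (negPf ik).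
Qed.

Lemma bruhat_is_supP (A : {set sym n.+1}) w :
  reflect ((forall x, x \in A -> bruhat x w) /\
           (forall y, (forall x, x \in A -> bruhat x y) -> bruhat w y))
          (bruhat_is_sup S A w).
Proof.
apply: (iffP andP) => [[/forall_inP ub /forallP lub]|[ub lub]]; split=> //.
- by move=> y le_y; apply: (implyP (lub y)); apply/forall_inP.
- exact/forall_inP.
- by apply/forallP => y; apply/implyP => /forall_inP; apply: lub.
Qed.

Lemma bruhat_is_sup_inj (A : {set sym n.+1}) w w' :
  bruhat_is_sup S A w -> bruhat_is_sup S A w' -> w = w'.
Proof.
move=> /bruhat_is_supP[ub lub] /bruhat_is_supP[ub' lub'].
by apply: bruhat_anti; [apply: lub | apply: lub'].
Qed.

Lemma DsetE z : Dset z = [set i | ascent z i].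
Proof. by apply/setP => i; rewrite !inE bruhat_lt_last. Qed.

Lemma PsetE z w B : (B \in Pset z w) =
  (B \subset Dset z) && bruhat_is_sup S (z |: cube z B) w.
Proof.
rewrite inE; congr (_ && _).
by apply/forall_inP/subsetP => BD i /BD; rewrite inE.
Qed.

(** Since Bruhat order is pointwise comparison of ranks, a permutation whose rank is the pointwise
    maximum over a family is its supremum. *)
Lemma jump_is_sup z B w : B \subset Dset z -> jump z B w ->
  bruhat_is_sup S (z |: cube z B) w.
Proof.
rewrite DsetE => /subsetP BD J; apply/bruhat_is_supP; split=> [x|y le_y].
  case/setU1P => [->|/imsetP[i iB ->]]; apply/bruhatP => a b; rewrite J ?leq_addr //.
  have := BD _ iB; rewrite inE => zi; rewrite rank_last // leq_add2l.
  case zabi: in_rect => //.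
  by have -> : [exists j in B, in_rect z a b j] by apply/exists_inP; exists i.
apply/bruhatP => a b; rewrite J.
case: exists_inP => [[i iB zabi]|_] /=; last by rewrite addn0; apply/bruhat_rank/le_y/setU11.
have := BD _ iB; rewrite inE => zi.
have : bruhat (last_transp i * z)%g y by apply/le_y/setU1r/imset_f.
by move=> /(bruhat_rank a b); rewrite rank_last // zabi.
Qed.

Lemma is_sup_jump z B w : B \subset Dset z ->
  bruhat_is_sup S (z |: cube z B) w <-> jump z B w.
Proof.
move=> BD; split=> [sup_w|]; last exact: jump_is_sup.
have [w' J] := jump_ex z B.
by rewrite (bruhat_is_sup_inj sup_w (jump_is_sup BD J)).
Qed.

Lemma is_sup_cube z B w : B != set0 -> B \subset Dset z ->
  bruhat_is_sup S (z |: cube z B) w = bruhat_is_sup S (cube z B) w.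
Proof.
case/set0Pn => i iB /subsetP BD.
have le_z y : (forall x, x \in cube z B -> bruhat x y) -> bruhat z y.
  move=> le_y; apply: bruhat_trans (le_y _ (imset_f _ iB)).
  by have := BD _ iB; rewrite inE => /andP[].
have le_zU y : (forall x, x \in cube z B -> bruhat x y) ->
    forall x, x \in z |: cube z B -> bruhat x y.
  by move=> le_y x /setU1P[->|/le_y//]; apply: le_z.
apply/bruhat_is_supP/bruhat_is_supP => -[ub lub]; split.
- by move=> x xB; apply/ub/setU1r.
- by move=> y /le_zU/lub.
- exact: le_zU.
- by move=> y le_y; apply: lub => x xB; apply/le_y/setU1r.
Qed.

Lemma bruhat_sup_cube z B : B != set0 -> B \subset Dset z ->
  bruhat_is_sup S (cube z B) (bruhat_sup S (cube z B)).
Proof.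
(* [jump_ex] supplies a supremum, so the default value 1 is not taken. *)
move=> B0 BD; rewrite /bruhat_sup; case: pickP => //= no_sup.
have [w J] := jump_ex z B.
by have := no_sup w; rewrite -is_sup_cube // jump_is_sup.
Qed.
End Jump.

(** * The Coxeter element w_0 w_0^J as a cycle, and the suffixes of its word *)

Section Cycle.
Variable n : nat.
Implicit Types (w x y z : sym n.+1) (i : 'I_n).
Local Notation S := (simples n).
Local Notation ell := (ell S).

Definition next i : 'I_n.+1 := lift ord0 i.

Lemma nextE i : next i = (wide i).+1 :> nat.
Proof. by rewrite lift0. Qed.

(** The suffix s_k ... s_(n-1) of the Coxeter word; a natural number as index allows the empty
    suffix [cyc n], where the downward inductions start. *)
Definition cyc (k : nat) : sym n.+1 :=
  (\prod_(k <= j < n) transp (inord j) (inord j.+1))%g.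

Lemma cycn : cyc n = 1%g.
Proof. by rewrite /cyc big_geq. Qed.

Lemma cyc_rec i : cyc i = (simple_transp i * cyc i.+1)%g.
Proof.
rewrite /cyc big_ltn //; congr (transp _ _ * _)%g; apply: val_inj.
  by rewrite /= inordK //; apply: leqW.
by rewrite /= inordK ?liftE // ltnS.
Qed.

Lemma ind_down (P : nat -> Prop) :
  P n -> (forall i, P i.+1 -> P i) -> forall k, k <= n -> P k.
Proof.
move=> Pn IH k le_kn; rewrite -(subKn le_kn).
elim: (n - k) => [|m Pm]; first by rewrite subn0.
(* For m at least n the truncated subtraction has already reached 0. *)
have [lt_mn|] := ltnP m n; last by move=> le; rewrite (_ : n - m.+1 = n - m) //; lia.
have lt : n - m.+1 < n by lia.
by apply: (IH (Ordinal lt)); rewrite /= subnSK.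
Qed.

Lemma pos_cyc (k : nat) (j : 'I_n.+1) : k <= n ->
  pos (cyc k) j = (if j < k then j : nat else if j == k :> nat then n else j.-1) :> nat.
Proof.
move=> le_kn; move: k le_kn j; apply: ind_down => [j|i IH j].
  rewrite cycn pos1; have := ltn_ord j; rewrite ltnS => le_j.
  by do ![case: ifP => ?]; lia.
rewrite cyc_rec pos_transpM IH val_tperm widenE liftE.
have := ltn_ord j; have := ltn_ord i.
case: (eqVneq (nat_of_ord j) i) => ?; case: (eqVneq (nat_of_ord j) i.+1) => ? /=.
all: by do ![case: ifP => ?]; lia.
Qed.

(** Moving s_i to the right of [cyc i.+1] conjugates it into (i, n), since the inverse of [cyc i.+1]
    fixes i and sends i+1 to n. This is how the transpositions (i, n) enter. *)
Lemma cyc_rec_last i : cyc i = (cyc i.+1 * last_transp i)%g.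
Proof.
apply: posP => j; apply: val_inj; rewrite /= posM pos_transp val_tperm.
rewrite (pos_cyc j (ltnW (ltn_ord i))).
have := pos_cyc j (ltn_ord i); move: (nat_of_ord (pos _ j)) => p /=.
have := ltn_ord j; have := ltn_ord i.
case: (ltngtP (nat_of_ord j) i.+1) => ? ? ? pE; do ![case: ifP => ?]; lia.
Qed.

Lemma pos_cyc_wide z i : pos (cyc i * z)%g (wide i) = pos z ord_max.
Proof.
rewrite posM; congr pos; apply: val_inj.
by rewrite /= (pos_cyc _ (ltnW (ltn_ord i))) /= ltnn eqxx.
Qed.

Lemma pos_cyc_next z i : pos (cyc i * z)%g (next i) = pos z (wide i).
Proof.
rewrite posM; congr pos; apply: val_inj.
rewrite /= (pos_cyc _ (ltnW (ltn_ord i))) nextE /=; do ![case: ifP => ?]; lia.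
Qed.

Lemma simple_transpKg i w : (simple_transp i * (simple_transp i * w) = w)%g.
Proof. exact: transpKg. Qed.

Lemma simple_cyc z i : (simple_transp i * (cyc i * z) = cyc i.+1 * z)%g.
Proof. by rewrite cyc_rec -mulgA simple_transpKg. Qed.

Lemma cyc_last z i : (cyc i * z = cyc i.+1 * (last_transp i * z))%g.
Proof. by rewrite cyc_rec_last mulgA. Qed.

(** In [cyc i * z] the letters i and i+1 have the places of n and i in z, so an ascent of z becomes
    a descent for s_i. *)
Lemma ell_cyc_ascent z i : ascent z i -> ell (cyc i * z)%g = (ell (cyc i.+1 * z)%g).+1.
Proof.
rewrite /ascent -(pos_cyc_wide z i) -(pos_cyc_next z i) -simple_cyc => lt.
exact: ell_adjacent_down (nextE i) lt.
Qed.

Lemma ell_cyc_descent z i : ~~ ascent z i -> ell (cyc i.+1 * z)%g = (ell (cyc i * z)%g).+1.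
Proof.
rewrite /ascent -(pos_cyc_wide z i) -(pos_cyc_next z i) -simple_cyc => nlt.
apply: ell_adjacent_up (nextE i) _; rewrite ltn_neqAle leqNgt nlt andbT.
by rewrite pos_eqE nextE neq_ltn leqnn.
Qed.

Lemma mem_gen_simple i w (K : {set sym n.+1}) : simple_transp i \in K -> 
  w \in <<K>>%g -> (simple_transp i * w)%g \in <<K>>%g.
Proof. by move=> iK wK; rewrite groupM // mem_gen. Qed.

Lemma longest_descent (K : {set sym n.+1}) i : simple_transp i \in K ->
  pos (longest S K) (next i) < pos (longest S K) (wide i).
Proof.
rewrite /longest; case: arg_maxnP => [|w w_in w_max iK]; first exact: group1.
rewrite ltn_neqAle pos_eqE nextE neq_ltn ltnSn orbT leqNgt /=; apply/negP => lt.
have := w_max _ (mem_gen_simple iK w_in).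
by rewrite (ell_adjacent_up (nextE i) lt) /= ltnn.
Qed.

Lemma longest_in (K : {set sym n.+1}) : longest S K \in <<K>>%g.
Proof. by rewrite /longest; case: arg_maxnP => //; apply: group1. Qed.

(** Every s_i is a left descent, so [pos] decreases strictly; its complement [f] increases strictly
    within 0, ..., n and is the identity. *)
Lemma pos_longest_simples (j : 'I_n.+1) : pos (longest S S) j = n - j :> nat.
Proof.
pose f (k : nat) : nat := n - pos (longest S S) (inord k).
have inc k : k < n -> f k < f k.+1.
  move=> lt_kn; have := @longest_descent S (Ordinal lt_kn) (imset_f _ _).
  rewrite (_ : next _ = inord k.+1); last by apply: val_inj; rewrite [LHS]nextE /= inordK.
  rewrite (_ : wide _ = inord k); last by apply: val_inj; rewrite /= inordK // ltnW.
  by move=> /(_ isT); rewrite /f; have := ltn_ord (pos (longest S S) (inord k)); lia.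
have fj : f j = n - pos (longest S S) j by rewrite /f inord_val.
have := ltn_ord j; have := ltn_ord (pos (longest S S) j).
have gap0 : f 0 + j <= f (0 + j).
  by apply: leq_gap => k lt; apply: inc; have := ltn_ord j; lia.
have gap1 : f j + (n - j) <= f (j + (n - j)).
  by apply: leq_gap => k lt; apply: inc; have := ltn_ord j; lia.
have fn : f (j + (n - j)) <= n by rewrite leq_subr.
by move: gap0; rewrite add0n fj; move: fj; lia.
Qed.

Lemma pos_longest_Jset_last : pos (longest S (Jset n)) ord_max = ord_max.
Proof.
have /gen_prodgP[m [c cJ ->]] := longest_in (Jset n).
elim/big_rec: _ => [|l x _ IH]; first by rewrite pos1.
have /imsetP[i] := cJ l; rewrite inE => lt_i ->.
by rewrite pos_transpM tpermD // -val_eqE /= ?/bump ?leq0n; have := ltn_ord i; lia.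
Qed.

(** The same argument on the letters 0, ..., n-1, which stay among themselves because n is fixed. *)
Lemma pos_longest_Jset (j : 'I_n.+1) : j < n ->
  pos (longest S (Jset n)) j = n.-1 - j :> nat.
Proof.
move=> lt_jn.
have lt_n k : k < n -> pos (longest S (Jset n)) (inord k) < n.
  move=> lt_kn; rewrite ltn_neqAle -ltnS ltn_ord andbT.
  have := pos_eqE (longest S (Jset n)) (inord k) ord_max.
  rewrite pos_longest_Jset_last /= (inordK (ltnW lt_kn : k < n.+1)) => ->.
  by rewrite neq_ltn lt_kn.
pose f (k : nat) : nat := n.-1 - pos (longest S (Jset n)) (inord k).
have inc k : k.+1 < n -> f k < f k.+1.
  move=> lt_kn; have := @longest_descent (Jset n) (Ordinal (ltnW lt_kn)).
  rewrite imset_f ?inE // => /(_ isT).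
  rewrite (_ : next _ = inord k.+1); last first.
    by apply: val_inj; rewrite [LHS]nextE /= inordK // ltnW.
  rewrite (_ : wide _ = inord k); last by apply: val_inj; rewrite /= inordK // ltnW // ltnW.
  by rewrite /f; have := lt_n k; lia.
have fj : f j = n.-1 - pos (longest S (Jset n)) j by rewrite /f inord_val.
have := lt_n j lt_jn; rewrite inord_val.
have gap0 : f 0 + j <= f (0 + j) by apply: leq_gap => k lt; apply: inc; lia.
have gap1 : f j + (n.-1 - j) <= f (j + (n.-1 - j)).
  by apply: leq_gap => k lt; apply: inc; lia.
have fn : f (j + (n.-1 - j)) <= n.-1 by rewrite leq_subr.
by move: gap0; rewrite add0n fj; move: fj; lia.
Qed.

(** Two reversals are composed: 0 goes to n and stays there, any other j goes to n - j and then to n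
    - 1 - (n - j) = j - 1. *)
Lemma longest_mul : (longest S S * longest S (Jset n))%g = cyc 0.
Proof.
apply: posP => j; apply: val_inj; rewrite /= posM pos_cyc // ltn0.
have pE := pos_longest_simples j; have := ltn_ord j; rewrite ltnS => le_jn.
have [j0|j0] := eqVneq (nat_of_ord j) 0.
  rewrite (_ : pos _ j = ord_max); last by apply: val_inj; rewrite /= pE j0 subn0.
  by rewrite pos_longest_Jset_last.
by rewrite pos_longest_Jset pE; lia.
Qed.
End Cycle.

Import GRing.Theory.
Local Open Scope ring_scope.

(** * Weighted sums over subsets and their recursion *)

Section SubsetSums.
Variables (T : finType) (V : nmodType).
Implicit Types (A B : {set T}) (k : T).

Lemma sum_subsetU1 (F : {set T} -> V) (P : pred {set T}) k A : k \notin A ->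
  \sum_(B : {set T} | (B \subset k |: A) && P B) F B =
  \sum_(B : {set T} | (B \subset A) && P B) F B +
  \sum_(B : {set T} | (B \subset A) && P (k |: B)) F (k |: B).
Proof.
move=> kA; rewrite (bigID (fun B : {set T} => k \in B)) /= addrC; congr (_ + _).
  apply: eq_bigl => B; rewrite andbAC; congr (_ && _).
  apply/andP/idP => [[/subsetP BA kB]|BA].
    apply/subsetP => x xB; case/setU1P: (BA x xB) => // xk.
    by rewrite -xk xB in kB.
  by rewrite (subset_trans BA (subsetUr _ _)) (contra (subsetP BA k)).
rewrite (reindex_onto (fun B => k |: B) (fun B : {set T} => B :\ k)) /=; last first.
  by move=> B /andP[_ kB]; rewrite setD1K.
apply: eq_bigl => B; rewrite setU11 andbT; apply/andP/andP => -[].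
  move=> /andP[BA PB] /eqP kBE; split=> //.
  have kB : k \notin B by rewrite -kBE setD11.
  apply/subsetP => x xB; have /setU1P[xk|//] := subsetP BA x (setU1r _ xB).
  by rewrite -xk xB in kB.
move=> BA PB; rewrite setUS // PB; split=> //; rewrite setU1K //.
by apply: contra kA; apply: (subsetP BA).
Qed.
End SubsetSums.

Section JumpSums.
Variable n : nat.
Implicit Types (w x y z : sym n.+1) (i k : 'I_n) (A B E : {set 'I_n}).
Local Notation S := (simples n).

(** [A] may contain letters that are not ascents of z, so that the recursion can run through all of
    k, ..., n-1; [jump_sum_descents] then returns to [Dset z]. *)
Definition jump_sum z A w : laurent :=
  \sum_(B : {set 'I_n} | (B \subset A) && `[< jump z B w >]) (q - 1) ^+ #|B|.

Lemma jump_sum0 z w : jump_sum z set0 w = (z == w)%:R.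
Proof.
rewrite /jump_sum; have [<-|z_neq] := eqVneq z w.
  rewrite (big_pred1 set0) ?cards0 // => B; rewrite subset0 /=.
  by case: eqP => [->|//]; apply/asboolP/jump0.
rewrite big_pred0 // => B; rewrite subset0; case: eqP => // -> /=.
apply/asboolP => /(jump_inj (jump0 z)) zw; by rewrite zw eqxx in z_neq.
Qed.

(** Adding [k] to a subset keeps the supremum and multiplies the weight by q - 1, so each term
    occurs with the factor 1 + (q - 1) = q. *)
Lemma jump_sum_descent z A k w : k \notin A -> ~~ ascent z k ->
  jump_sum z (k |: A) w = q * jump_sum z A w.
Proof.
move=> kA zk; rewrite /jump_sum sum_subsetU1 //.
have -> : q = 1 + (q - 1) by rewrite addrC subrK.
rewrite mulrDl mul1r addrAC subrr add0r; congr (_ + _); rewrite mulr_sumr.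
apply: eq_big => [B|B /andP[BA _]].
  by congr (_ && _); apply/asboolP/asboolP => /jump_setU1_descent; apply.
by rewrite cardsU1 (contra (subsetP BA k)) // exprS.
Qed.

(** By [jump_setU1_ascent], the subsets containing [k] are subsets of [A] seen from (k, n) z, with
    one more factor q - 1. *)
Lemma jump_sum_ascent z A k w : (forall i, i \in A -> k < i)%N -> ascent z k ->
  jump_sum z (k |: A) w = jump_sum z A w + (q - 1) * jump_sum (last_transp k * z)%g A w.
Proof.
move=> lt_kA zk; have kA : k \notin A by apply/negP => /lt_kA; rewrite ltnn.
rewrite /jump_sum sum_subsetU1 //; congr (_ + _); rewrite mulr_sumr.
apply: eq_big => [B|B /andP[BA _]].
  apply: andb_id2l => /subsetP BA.
  have J := jump_setU1_ascent w zk (fun i iB => lt_kA i (BA i iB)).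
  by apply/asboolP/asboolP => /J.
by rewrite cardsU1 (contra (subsetP BA k)) // exprS.
Qed.

Lemma jump_sum_descents z A E w : [disjoint E & A] ->
  (forall i, i \in E -> ~~ ascent z i) ->
  jump_sum z (E :|: A) w = q ^+ #|E| * jump_sum z A w.
Proof.
have [m] := ubnP #|E|; elim: m E => // m IH E lt_m EA zE.
have [->|[k kE]] := set_0Vmem E; first by rewrite cards0 set0U mul1r.
move: lt_m; rewrite (cardsD1 k) kE add1n ltnS => lt_m.
have sub : E :\ k \subset E by apply: subsetDl.
rewrite -{1}(setD1K kE) -setUA jump_sum_descent ?zE //; last first.
  by rewrite in_setU setD11 (disjointFr EA kE).
rewrite IH ?exprS ?mulrA // => [|i /(subsetP sub)/zE//].
exact: disjointWl EA.
Qed.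

Lemma jump_sum_Pset z w : jump_sum z (Dset z) w = \sum_(B in Pset z w) (q - 1) ^+ #|B|.
Proof.
apply: eq_bigl => B; rewrite [in RHS]PsetE.
apply: andb_id2l => BD; apply/asboolP/idP => /(is_sup_jump _ BD)//.
Qed.
End JumpSums.

(** * Coordinates in a basis and in the twisted bases f *)

Section Dual.
Variables (W : finGroupType) (H : unitAlgType laurent) (b : W -> H).
Hypothesis basis_b : is_basis b.

Lemma dual_expand x : x = \sum_w dual b w x *: b w.
Proof.
rewrite /dual; set X := (X in classical_sets.xget _ X).
suff: X (classical_sets.xget [ffun=> 0] X) by [].
by apply: classical_sets.xgetPex; have [a [aE _]] := basis_b x; exists a.
Qed.

(** [dual] takes chosen coordinates; the uniqueness in [is_basis] identifies them with those of any
    given expansion. *)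
Lemma dual_sum (a : W -> laurent) s : dual b s (\sum_w a w *: b w) = a s.
Proof.
set x := \sum_w _; have [c [_ c_uniq]] := basis_b x.
have E1 : c = [ffun w => dual b w x].
  by apply: c_uniq; rewrite {1}[x]dual_expand; apply: eq_bigr => w _; rewrite ffunE.
have E2 : c = [ffun w => a w].
  by apply: c_uniq; apply: eq_bigr => w _; rewrite ffunE.
by have := congr1 (fun f : {ffun W -> laurent} => f s) E1; rewrite E2 !ffunE.
Qed.

Lemma dual_linear s k x y : dual b s (k *: x + y) = k * dual b s x + dual b s y.
Proof.
rewrite {1}[x]dual_expand {1}[y]dual_expand scaler_sumr -big_split /=.
under eq_bigr => w _ do rewrite scalerA -scalerDl.
by rewrite dual_sum.
Qed.

Lemma dualD s x y : dual b s (x + y) = dual b s x + dual b s y.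
Proof. by rewrite -[x]scale1r dual_linear mul1r scale1r. Qed.

Lemma dual0 s : dual b s 0 = 0.
Proof. by apply: (addrI (dual b s 0)); rewrite -dualD !addr0. Qed.

Lemma dualZ s k x : dual b s (k *: x) = k * dual b s x.
Proof. by rewrite -[k *: x]addr0 dual_linear dual0 addr0. Qed.

Lemma dual_big s (I : finType) (F : I -> H) :
  dual b s (\sum_i F i) = \sum_i dual b s (F i).
Proof. exact: (big_morph _ (dualD s) (dual0 s)). Qed.

Lemma dual_basis s w : dual b s (b w) = (s == w)%:R.
Proof.
have {1}-> : b w = \sum_u (u == w)%:R *: b u.
  rewrite (bigD1 w) //= eqxx scale1r big1 ?addr0 // => u /negPf->.
  by rewrite scale0r.
exact: dual_sum.
Qed.
End Dual.

Section TwistedBasis.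
Variables (W : finGroupType) (H : unitAlgType laurent) (h : W -> H) (t : W).
Hypotheses (basis_h : is_basis h) (ht_unit : h t \is a GRing.unit).

(** Multiplication by the unit [h t] is injective and sends [fbasis h t w] to [h (t * w)]. *)
Lemma sum_fbasis (a : W -> laurent) x :
  x = \sum_w a w *: fbasis h t w <-> h t * x = \sum_w a (t^-1 * w)%g *: h w.
Proof.
have -> : \sum_w a (t^-1 * w)%g *: h w = h t * \sum_w a w *: fbasis h t w.
  rewrite mulr_sumr (reindex_inj (mulgI t)); apply: eq_bigr => w _.
  by rewrite mulKg /fbasis -scalerAr mulVKr.
by split=> [->//|]; apply: mulrI.
Qed.

Lemma fbasis_is_basis : is_basis (fbasis h t).
Proof.
move=> x; exists [ffun w => dual h (t * w)%g (h t * x)]; split.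
  apply/sum_fbasis; rewrite {1}[h t * x](dual_expand basis_h).
  by apply: eq_bigr => w _; rewrite ffunE mulVKg.
move=> a /sum_fbasis aE; apply/ffunP => w.
by rewrite ffunE aE (dual_sum basis_h (fun w => a (t^-1 * w)%g)) mulKg.
Qed.

Lemma dual_fbasis s x : dual (fbasis h t) s x = dual h (t * s)%g (h t * x).
Proof.
have /sum_fbasis-> := dual_expand fbasis_is_basis x.
by rewrite (dual_sum basis_h (fun w => dual (fbasis h t) (t^-1 * w)%g x)) mulKg.
Qed.
End TwistedBasis.

(** * Left multiplication in the Hecke algebra *)

Section Hecke.
Variables (n : nat) (H : unitAlgType laurent) (h : sym n.+1 -> H).
Local Notation S := (simples n).
Local Notation ell := (ell S).
Hypothesis hecke_h : is_hecke S h.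
Implicit Types (w x y z : sym n.+1) (i k : 'I_n).

Lemma hecke_basis : is_basis h.
Proof. by case: hecke_h. Qed.

(** Additivity of lengths makes [h 1] a left unit on each [h w]; expanding 1 in the basis gives the
    claim. *)
Lemma hecke1 : h 1%g = 1.
Proof.
have [_ hM _] := hecke_h.
have h1w w : h 1%g * h w = h w by rewrite hM ?mul1g // ellE inv1.
rewrite -[LHS]mulr1 [1 in LHS](dual_expand hecke_basis) mulr_sumr.
rewrite [RHS](dual_expand hecke_basis); apply: eq_bigr => w _.
by rewrite -scalerAr h1w.
Qed.

Lemma ell_simple i : ell (simple_transp i) = 1%N.
Proof.
rewrite -[simple_transp i]mulg1 (ell_adjacent_up (nextE i)) ?ellE ?inv1 //.
by rewrite !pos1 nextE.
Qed.

Lemma hecke_quad i : h (simple_transp i) * h (simple_transp i) =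
  alpha *: h (simple_transp i) + 1.
Proof.
have [_ _ /(_ _ (mem_simples (nextE i)))] := hecke_h.
set s := h _; rewrite mulrDl !mulrBr -!scalerAr -!scalerAl !mulr1 !mul1r scalerA.
rewrite mulVr ?v_unit // scale1r /alpha scalerBl => E; apply/eqP.
rewrite -subr_eq0 -E; apply/eqP.
by rewrite opprD opprB !addrA; congr (_ - _); rewrite addrAC -!addrA [- _ + _]addrC.
Qed.

Lemma hecke_simple_up i w : (pos w (wide i) < pos w (next i))%N ->
  h (simple_transp i) * h w = h (simple_transp i * w)%g.
Proof.
have [_ hM _] := hecke_h; move=> lt; rewrite hM //.
by rewrite (ell_adjacent_up (nextE i) lt) ell_simple.
Qed.

Lemma hecke_simple_down i w : (pos w (next i) < pos w (wide i))%N ->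
  h (simple_transp i) * h w = h (simple_transp i * w)%g + alpha *: h w.
Proof.
move=> lt; have up : h (simple_transp i) * h (simple_transp i * w)%g = h w.
  by rewrite hecke_simple_up ?simple_transpKg // !pos_transpM tpermL tpermR.
by rewrite -{1}up mulrA hecke_quad mulrDl mul1r -scalerAl up addrC.
Qed.

(* The transpose of left multiplication by h_s. *)
Lemma dual_mul_simple i y (x : H) :
  dual h y (h (simple_transp i) * x) = dual h (simple_transp i * y)%g x +
    (pos y (next i) < pos y (wide i))%N%:R * alpha * dual h y x.
Proof.
have D := dual_basis hecke_basis.
rewrite {1}[x](dual_expand hecke_basis) mulr_sumr (dual_big hecke_basis).
transitivity (\sum_w (dual h w x * (simple_transp i * y == w)%g%:R +
   dual h w x * ((pos y (next i) < pos y (wide i))%N%:R * alpha * (y == w)%:R))).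
  apply: eq_bigr => w _; rewrite -scalerAr (dualZ hecke_basis) -mulrDr; congr (_ * _).
  have sE : (y == simple_transp i * w)%g = (simple_transp i * y == w)%g.
    by rewrite -{1}[y](simple_transpKg i y) (inj_eq (mulgI _)).
  case: (ltngtP (pos w (wide i)) (pos w (next i))) => [lt|lt|/eqP].
  - rewrite hecke_simple_up // D sE; have [->|] := eqVneq y w; last by rewrite mulr0 addr0.
    by rewrite ltnNge ltnW // !mul0r addr0.
  - rewrite hecke_simple_down // (dualD hecke_basis) (dualZ hecke_basis) !D sE.
    by have [->|] := eqVneq y w; rewrite ?lt ?mul1r ?mulr0.
  - by rewrite pos_eqE nextE eqn_leq ltnn andbF.
have delta (F : sym n.+1 -> laurent) u : \sum_w F w * (u == w)%:R = F u.
  rewrite (bigD1 u) //= eqxx mulr1 big1 ?addr0 // => w.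
  by rewrite eq_sym => /negPf->; rewrite mulr0.
rewrite big_split /= delta; under [X in _ + X]eq_bigr => w _ do rewrite mulrA.
by rewrite delta mulrC.
Qed.

Lemma hecke_cyc_rec i : h (cyc n i) = h (simple_transp i) * h (cyc n i.+1).
Proof.
rewrite hecke_simple_up -?cyc_rec //.
by rewrite !pos_cyc // nextE widenE ltnSn ltnn eqxx ltn_ord.
Qed.

(** By the quadratic relation, each h_s has the inverse h_s - alpha. *)
Lemma hecke_cyc_unit : h (cyc n 0) \is a GRing.unit.
Proof.
apply: (ind_down (P := fun m : nat => h (cyc n m) \is a GRing.unit)) (leq0n n) => [|i IH].
  by rewrite cycn hecke1 unitr1.
rewrite hecke_cyc_rec unitrMl //; apply/unitrP.
exists (h (simple_transp i) - alpha%:A).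
by rewrite mulrBl mulrBr -scalerAl -scalerAr mul1r mulr1 hecke_quad addrC addKr.
Qed.

(** This is [dual_mul_simple] at y = [cyc i * z]: s_i y is [cyc i.+1 * z], y itself is [cyc i.+1]
    times (i, n) z, and s_i is a descent of y exactly at an ascent of z. *)
Lemma dual_cyc_rec i z (x : H) :
  dual h (cyc n i * z)%g (h (cyc n i) * x) =
  dual h (cyc n i.+1 * z)%g (h (cyc n i.+1) * x) +
  (ascent z i)%:R * alpha *
    dual h (cyc n i.+1 * (last_transp i * z))%g (h (cyc n i.+1) * x).
Proof.
by rewrite hecke_cyc_rec -mulrA dual_mul_simple simple_cyc pos_cyc_wide pos_cyc_next -cyc_last.
Qed.
End Hecke.

(** * The R-polynomials as sums over subsets *)

Lemma q_unit : q \is a GRing.unit.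
Proof. by rewrite unitrV unitrX ?v_unit. Qed.

Lemma qE : q = v ^ (- 2%:Z).
Proof. by []. Qed.

Lemma q_sub1 : q - 1 = v^-1 * alpha.
Proof. by rewrite /alpha mulrBr mulVr ?v_unit // -expr2 exprVn. Qed.

Lemma vD (a b : int) : v ^ (a + b) = v ^ a * v ^ b.
Proof. exact: exprzDr v_unit _ _. Qed.

Section RPolynomials.
Variables (n : nat) (H : unitAlgType laurent) (h : sym n.+1 -> H).
Local Notation S := (simples n).
Local Notation ell := (ell S).
Hypothesis hecke_h : is_hecke S h.
Implicit Types (w x y z : sym n.+1) (i : 'I_n) (B : {set 'I_n}).

Definition tail (k : nat) : {set 'I_n} := [set i : 'I_n | (k <= i)%N].

Lemma tailn : tail n = set0.
Proof. by apply/setP => i; rewrite !inE leqNgt ltn_ord. Qed.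

Lemma tail_rec i : tail i = i |: tail i.+1.
Proof. by apply/setP => j; rewrite !inE leq_eqVlt eq_sym val_eqE. Qed.

(** Passing from i+1 to i, the exponent of v is kept when an ascent keeps z, drops by one when it
    moves z, so that alpha becomes q - 1, and drops by two at a descent, which gives the factor
    q. *)
Lemma dual_cyc_jump_sum (k : nat) : (k <= n)%N -> forall z w,
  v ^ ((ell (cyc n k * z)%g)%:Z - (n - k)%:Z - (ell w)%:Z) *
    dual h (cyc n k * z)%g (h (cyc n k) * h w) = jump_sum z (tail k) w.
Proof.
move: k; apply: ind_down => [|i IH] z w.
  rewrite cycn mul1g (hecke1 hecke_h) mul1r (dual_basis (hecke_basis hecke_h)).
  rewrite tailn jump_sum0 subnn subr0.
  by have [->|] := eqVneq z w; rewrite ?mulr0 // subrr expr0z mulr1.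
have lt_in := ltn_ord i; rewrite tail_rec (dual_cyc_rec hecke_h).
have [zi|zi] := boolP (ascent z i).
  rewrite jump_sum_ascent //; last by move=> j; rewrite inE.
  rewrite -!IH mulrDr mul1r; congr (_ + _).
    by rewrite (ell_cyc_ascent zi); congr (v ^ _ * _); lia.
  rewrite -cyc_last q_sub1 mulrA [RHS]mulrA; congr (_ * _).
  rewrite mulrAC; congr (_ * _); rewrite -[v^-1]/(v ^ (- 1%:Z)) -vD; congr (v ^ _).
  by lia.
rewrite jump_sum_descent // ?inE ?ltnn // -IH !mul0r addr0 mulrA; congr (_ * _).
by rewrite qE -vD (ell_cyc_descent zi); congr (v ^ _); lia.
Qed.

Definition descents (k : nat) z := [set i : 'I_n | (k <= i)%N && ~~ ascent z i].

(** Each factor s_i, i >= k, raises the length at a non-ascent's complement and lowers it otherwise: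
    the length of [cyc k * z] is that of z plus n - k, minus twice the number of [descents k z]. *)
Lemma v_ell_cyc (k : nat) z : (k <= n)%N ->
  v ^ ((ell (cyc n k * z)%g)%:Z - (n - k)%:Z) = v ^ (ell z)%:Z * q ^+ #|descents k z|.
Proof.
move: k; apply: ind_down => [|i IH].
  rewrite cycn mul1g subnn subr0 (_ : descents n z = set0) ?cards0 ?mulr1 //.
  by apply/setP => i; rewrite !inE leqNgt ltn_ord.
have lt_in := ltn_ord i; have [zi|zi] := boolP (ascent z i).
  have -> : descents i z = descents i.+1 z.
    apply/setP => j; rewrite !inE leq_eqVlt; case: eqP => //= /val_inj <-.
    by rewrite zi ltnn.
  by rewrite -IH (ell_cyc_ascent zi); congr (v ^ _); lia.
have -> : descents i z = i |: descents i.+1 z.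
  apply/setP => j; rewrite !inE leq_eqVlt eq_sym val_eqE andb_orl.
  by case: eqP => // ->; rewrite zi.
rewrite cardsU1 inE ltnn exprS mulrCA -IH (ell_cyc_descent zi) qE -vD.
by congr (v ^ _); lia.
Qed.

Lemma Rpoly_dual z w : Rpoly S h (Jset n) z w =
  v ^ ((ell z)%:Z - (ell w)%:Z) * dual h (cyc n 0 * z)%g (h (cyc n 0) * h w).
Proof.
rewrite /Rpoly longest_mul dual_fbasis //; first exact: hecke_basis.
exact: hecke_cyc_unit.
Qed.

Lemma Rpoly_jump_sum z w : Rpoly S h (Jset n) z w = jump_sum z (Dset z) w.
Proof.
have qX : q ^+ #|descents 0 z| \is a GRing.unit by rewrite unitrX ?q_unit.
(* The non-ascents give the same power of q on both sides, and q is a unit. *)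
apply: (mulrI qX); rewrite -jump_sum_descents; first last.
- by move=> i; rewrite inE.
- rewrite disjoint_subset; apply/subsetP => i; rewrite !inE /= => zi.
  by rewrite bruhat_lt_last.
have -> : descents 0 z :|: Dset z = tail 0.
  by apply/setP => i; rewrite !inE bruhat_lt_last orNb.
rewrite -dual_cyc_jump_sum // Rpoly_dual mulrA vD [in RHS]vD; congr (_ * _).
by rewrite mulrA [q ^+ _ * _]mulrC -v_ell_cyc // -vD.
Qed.

Lemma Rpoly_Pset z w :
  Rpoly S h (Jset n) z w = \sum_(B in Pset z w) (q - 1) ^+ #|B|.
Proof. by rewrite Rpoly_jump_sum jump_sum_Pset. Qed.

(** A subset of [Dset z] belongs to [Pset z w] for just one w. The empty set is apart because the
    supremum of the empty cube is the identity, not z. *)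
Lemma mem_Pset z w B : (B \in Pset z w) =
  (B \subset Dset z) && (w == if B == set0 then z else bruhat_sup S (cube z B)).
Proof.
rewrite PsetE; apply: andb_id2l => BD.
have sup_B : bruhat_is_sup S (z |: cube z B)
               (if B == set0 then z else bruhat_sup S (cube z B)).
  case: eqP => [->|/eqP B0]; last by rewrite is_sup_cube // bruhat_sup_cube.
  by apply: jump_is_sup (jump0 z); apply: sub0set.
by apply/idP/eqP => [/bruhat_is_sup_inj/(_ sup_B)|->].
Qed.
End RPolynomials.

(** * The Q-polynomials and the hypercube formula *)

Lemma lconj_q : lconj q = q^-1.
Proof. by rewrite /q rmorphV ?rmorphXn ?unitrX ?v_unit //= lconj_v exprVn. Qed.

Lemma lconj_alpha : lconj alpha = - alpha.
Proof. by rewrite /alpha rmorphB rmorphV ?v_unit //= lconj_v invrK opprB. Qed.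

Lemma lconjM x y : lconj (x * y) = lconj x * lconj y.
Proof. exact: (rmorphM lconj). Qed.

Lemma lconj_vX (m : int) : lconj (v ^ m) = v ^ (- m).
Proof. by rewrite -exprz_inv -lconj_v; apply: (rmorphXz lconj); apply: v_unit. Qed.

Lemma alpha_neq0 : alpha != 0.
Proof.
apply/eqP => alpha0; have : v * alpha = 0 by rewrite alpha0 mulr0.
rewrite /alpha mulrBr divrr ?v_unit // -expr2 => /eqP; rewrite subr_eq0 => /eqP E.
have /(congr1 (fun p : {poly int} => p`_0)) : 1 = 'X^2 :> {poly int}.
  by apply/eqP; rewrite -tofrac_eq tofrac1 tofracXn -lval1 E expr2 lvalM.
by rewrite coef1 coefXn.
Qed.

Lemma one_subq_neq0 : 1 - q != 0.
Proof.
apply/eqP => q1; have := alpha_neq0; case/eqP.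
have := q_sub1; rewrite -opprB q1 oppr0 => /(congr1 ( *%R v)).
by rewrite mulr0 mulrA divrr ?v_unit // mul1r.
Qed.

(** The quotient is a Laurent polynomial, so the default 0 of [ldiv] is avoided. *)
Lemma ldivK x : ldiv (alpha * x) alpha = x.
Proof.
have a0 : lval alpha != 0 by rewrite lval_eq0 alpha_neq0.
by apply: val_inj; rewrite /ldiv lvalM mulrC mulKf // val_insubd (valP x).
Qed.

Lemma lval_exprz (x : laurent) (m : int) : x \is a GRing.unit ->
  lval (x ^ m) = lval x ^ m.
Proof. by move=> xU; apply: (rmorphXz val). Qed.

Lemma lval_sum (I : finType) (P : pred I) (F : I -> laurent) :
  lval (\sum_(i | P i) F i) = \sum_(i | P i) lval (F i).
Proof. exact: (raddf_sum val). Qed.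

Lemma lvalXn (x : laurent) m : lval (x ^+ m) = lval x ^+ m.
Proof. exact: (rmorphXn val). Qed.

Lemma lvalV (x : laurent) : x \is a GRing.unit -> lval x^-1 = (lval x)^-1.
Proof. exact: (rmorphV val). Qed.

Section QPolynomials.
Variables (n : nat) (H : unitAlgType laurent) (h c : sym n.+1 -> H).
Local Notation S := (simples n).
Local Notation ell := (ell S).
Hypothesis hecke_h : is_hecke S h.
Implicit Types (w x y z : sym n.+1) (i : 'I_n) (B : {set 'I_n}).

Lemma dual_KLpoly z w :
  dual h z (c w) = v ^ ((ell w)%:Z - (ell z)%:Z) * KLpoly S h c z w.
Proof. by rewrite /KLpoly mulrA -vD addrA subrK subrr expr0z mul1r. Qed.

Lemma dual_twisted_KLpoly z w :
  dual (fbasis h (longest S S * longest S (Jset n))%g) z (c w) =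
  v ^ ((ell w)%:Z - (ell z)%:Z) * \sum_(B : {set 'I_n} | B \subset Dset z)
    (q - 1) ^+ #|B| *
    KLpoly S h c (if B == set0 then z else bruhat_sup S (cube z B)) w.
Proof.
have f_basis : is_basis (fbasis h (longest S S * longest S (Jset n))%g).
  rewrite longest_mul.
  exact: fbasis_is_basis (hecke_basis hecke_h) (hecke_cyc_unit hecke_h).
rewrite {1}[c w](dual_expand (hecke_basis hecke_h)) (dual_big f_basis).
transitivity (\sum_x v ^ ((ell w)%:Z - (ell z)%:Z) *
    \sum_(B in Pset z x) (q - 1) ^+ #|B| * KLpoly S h c x w).
  apply: eq_bigr => x _; rewrite (dualZ f_basis) dual_KLpoly -mulr_suml.
  rewrite -(Rpoly_Pset hecke_h) /Rpoly -(mulrA _ _ (KLpoly _ _ _ _ _)) [RHS]mulrA -vD.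
  rewrite mulrAC -mulrA [dual _ _ _ * _]mulrC.
  rewrite (_ : (ell w)%:Z - (ell x)%:Z = (ell w)%:Z - (ell z)%:Z +
    ((ell z)%:Z - (ell x)%:Z)) ?mulrA //.
  by rewrite addrA subrK.
rewrite -mulr_sumr; congr (_ * _).
(* After the exchange of sums, each B retains a single x, by [mem_Pset]. *)
rewrite (exchange_big_dep (fun B => B \subset Dset z)) /=; last first.
  by move=> x B _; rewrite mem_Pset => /andP[].
apply: eq_bigr => B BD.
by rewrite (big_pred1 (if B == set0 then z else bruhat_sup S (cube z B))) // => x;
   rewrite mem_Pset BD.
Qed.

(** The denominator is cleared to stay inside Z[v, v^-1]. *)
Lemma Qpoly_hypercube z w :
  (1 - q) * Qpoly S h c (Jset n) z w =
  q ^ ((ell w)%:Z - (ell z)%:Z) *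
  \sum_(B : {set 'I_n} | (B != set0) && (B \subset Dset z))
    (q^-1 - 1) ^+ #|B| * lconj (KLpoly S h c (bruhat_sup S (cube z B)) w).
Proof.
pose P B := KLpoly S h c (bruhat_sup S (cube z B)) w.
(* The explicit quotient by alpha: q - 1 is alpha / v, and a nonempty B has at least one such
   factor. *)
pose Z := \sum_(B : {set 'I_n} | (B != set0) && (B \subset Dset z))
  v^-1 * (q - 1) ^+ #|B|.-1 * P B.
have ZE : alpha * Z =
    \sum_(B : {set 'I_n} | (B != set0) && (B \subset Dset z)) (q - 1) ^+ #|B| * P B.
  rewrite mulr_sumr; apply: eq_bigr => B /andP[B0 _].
  rewrite -card_gt0 in B0; rewrite -{2}(prednK B0) exprS q_sub1 !mulrA.
  by rewrite [alpha * _]mulrC.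
have -> : Qpoly S h c (Jset n) z w = v ^ ((ell z)%:Z - (ell w)%:Z + 1) *
    lconj (v ^ ((ell w)%:Z - (ell z)%:Z) * Z).
  rewrite /Qpoly /Icheck /= dual_twisted_KLpoly dual_KLpoly -mulrBr.
  (* The term of the empty set cancels the coefficient of h_z. *)
  rewrite (bigD1 set0) ?sub0set //= eqxx cards0 expr0 mul1r (addrC (KLpoly _ _ _ _ _)) addrK.
  rewrite (eq_bigl _ _ (fun B => andbC _ _)).
  rewrite (eq_bigr (fun B => (q - 1) ^+ #|B| * P B)) => [|B /andP[/negPf->]//].
  by rewrite -ZE [_ * (alpha * Z)]mulrCA ldivK.
(* Conjugation inverts q and changes the sign of alpha, which later turns q - 1 into 1 - q. *)
have -> : \sum_(B : {set 'I_n} | (B != set0) && (B \subset Dset z))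
    (q^-1 - 1) ^+ #|B| * lconj (P B) = - alpha * lconj Z.
  rewrite -lconj_alpha -rmorphM ZE rmorph_sum; apply: eq_bigr => B _.
  by rewrite rmorphM rmorphXn rmorphB rmorph1 /= lconj_q.
rewrite lconjM lconj_vX opprB; move: (lconj Z) => u; rewrite !mulrA; congr (_ * _).
have -> : 1 - q = - (v^-1 * alpha) by rewrite -q_sub1 opprB.
rewrite !mulNr mulrN [v^-1 * _]mulrC [q ^ _ * _]mulrC -!mulrA; congr (- (_ * _)).
by rewrite -[v^-1]/(v ^ (- 1%:Z)) qE exprz_exp -!vD; congr (v ^ _); lia.
Qed.
End QPolynomials.

Theorem theorem1p3 (n : nat) (H : unitAlgType laurent) (h : sym n.+1 -> H) :
  is_hecke (simples n) h ->
  (forall s w : sym n.+1,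
     Rpoly (simples n) h (Jset n) s w = \sum_(B in Pset s w) (q - 1) ^+ #|B|) /\
  (forall (s : sym n.+1) (B : {set 'I_n}), B != set0 -> B \subset Dset s ->
     bruhat_is_sup (simples n) (cube s B) (bruhat_sup (simples n) (cube s B))) /\
  (forall c : sym n.+1 -> H, is_KL_basis h c ->
   forall s w : sym n.+1,
     lval (Qpoly (simples n) h c (Jset n) s w) =
       lval q ^ ((ell (simples n) w)%:Z - (ell (simples n) s)%:Z)
       / (1 - lval q)
       * \sum_(B : {set 'I_n} | (B != set0) && (B \subset Dset s))
           ((lval q)^-1 - 1) ^+ #|B|
             * lval (lconj (KLpoly (simples n) h c
                                   (bruhat_sup (simples n) (cube s B)) w))).
Proof.
move=> hecke_h; split; first exact: Rpoly_Pset.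
split=> [s B|c _ s w]; first exact: bruhat_sup_cube.
have q1E : 1 - lval q = lval (1 - q) by rewrite lvalB lval1.
have q1_neq0 : 1 - lval q != 0 by rewrite q1E lval_eq0 one_subq_neq0.
(* In the field Q(v) the cleared denominator can be divided out again. *)
apply: (mulfI q1_neq0); rewrite {1}q1E -lvalM.
rewrite (Qpoly_hypercube c hecke_h) lvalM lval_exprz ?q_unit //.
rewrite [RHS]mulrA [_ * (_ / _)]mulrCA divff // mulr1; congr (_ * _).
rewrite lval_sum; apply: eq_bigr => B _.
by rewrite lvalM lvalXn lvalB lval1 lvalV ?q_unit.
Qed.
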